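(* Let $G$ be a po-group, $I$ a set, and $\lambda,\rho\colon I\to I$ bijections. Then for the kite pseudo effect algebra $K^{\lambda,\rho}_I(G)_{ea}$ there is a unital po-loop $(H,u)$ such that $\Gamma(H,u)$ is a pseudo effect algebra and $K^{\lambda,\rho}_I(G)_{ea}$ is isomorphic to $\Gamma(H,u)$.
   Context: **Pseudo effect algebra.** A pseudo effect algebra is a partial algebra $E=(E;+,0,1)$, with $+$ a partial binary operation and $0,1$ constants, such that for all $a,b,c\in E$: (i) $a+b$ and $(a+b)+c$ exist iff $b+c$ and $a+(b+c)$ exist, and then $(a+b)+c=a+(b+c)$; (ii) there is exactly one $d\in E$ and exactly one $e\in E$ with $a+d=e+a=1$; (iii) if $a+b$ exists, there are $d,e\in E$ with $a+b=d+a=b+e$; (iv) if $1+a$ or $a+1$ exists, then $a=0$. A homomorphism $h$ of pseudo effect algebras is a map with $h(1)=1$ such that whenever $a+b$ exists, $h(a)+h(b)$ exists and equals $h(a+b)$; an isomorphism is a bijective homomorphism whose inverse is a homomorphism. **Po-groups.** A po-group is a group with a partial order $\le$ such that $a\le b$ implies $xay\le xby$ for all $x,y$. For a multiplicatively written po-group $G$ with identity $e$, $G^+=\{g: g\ge e\}$ and $G^-=\{g: g\le e\}$. **Kite pseudo effect algebra.** $K^{\lambda,\rho}_{I}(G)_{ea}$ has universe the disjoint union $(G^+)^I\uplus(G^-)^I$ (so the constant sequence $e$ occurs once in each of the two parts, as two distinct elements). Elements of the part $(G^-)^I$ are written $\langle a_i^{-1}: i\in I\rangle$ with $a_i\in G^+$,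 and elements of the part $(G^+)^I$ are written $\langle f_j: j\in I\rangle$. Put $0=\langle e: j\in I\rangle\in(G^+)^I$ and $1=\langle e^{-1}: i\in I\rangle\in (G^-)^I$. The partial operation $+$ is: (I) $\langle a_i^{-1}\rangle+\langle b_i^{-1}\rangle$ is not defined; (II) $\langle a_i^{-1}\rangle+\langle f_j\rangle:=\langle a_i^{-1}f_{\rho^{-1}(i)}: i\in I\rangle$, defined whenever $f_{\rho^{-1}(i)}\le a_i$ for all $i\in I$; (III) $\langle f_j\rangle+\langle a_i^{-1}\rangle:=\langle f_{\lambda^{-1}(i)}a_i^{-1}: i\in I\rangle$, defined whenever $f_{\lambda^{-1}(i)}\le a_i$ for all $i\in I$; (IV) $\langle f_j\rangle+\langle g_j\rangle:=\langle f_jg_j: j\in I\rangle$, always defined. It is known that this is a pseudo effect algebra. **Po-loops.** A po-loop $(H;\cdot,e,\le)$ is a set $H$ with a binary operation $\cdot$, an element $e$ and a partial order $\le$ such that: for all $a,b\in H$ there are unique $x,y\in H$ with $a\cdot x=b$ and $y\cdot a=b$; $x\cdot e=x=e\cdot x$ for all $x\in H$; and $a\le b$ implies $c\cdot a\cdot d\le c\cdot b\cdot d$ for all $c,d\in H$ (i.e. left and right multiplications are order preserving). Associativity is not assumed. Powers are defined by $a^1=a$, $a^{n+1}=a^n a$. An element $u\ge e$ is a strong unit of $H$ if for every $g\in H$ there is an integer $n\ge 0$ (with $u^0=e$) such that $g\le u^n$; then $(H,u)$ is called a unital po-loop. Put $\Gamma(H,u)=\{h\in H: e\le h\le u\}$,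 with the partial operation: for $a,b\in\Gamma(H,u)$, $a+b$ is defined iff $ab\le u$, and then $a+b:=ab$. Saying that $\Gamma(H,u)$ is a pseudo effect algebra means that $(\Gamma(H,u);+,e,u)$ is one (with $0:=e$, $1:=u$). *)

(* Defs.v *)
From HB Require Import structures.
From mathcomp Require Import all_boot all_order.
From mathcomp Require Import boolp.

Set Implicit Arguments.
Unset Strict Implicit.
Unset Printing Implicit Defensive.

Import Order.TTheory.
Local Open Scope group_scope.
Local Open Scope order_scope.

(** * Pseudo effect algebras *)

(** [padd a b = Some c] means that a + b exists and equals c;
    [padd a b = None] means that a + b does not exist. *)
Record partial_algebra := PartialAlgebra {
  pcarrier :> Type;
  padd : pcarrier -> pcarrier -> option pcarrier;
  pzero : pcarrier;
  pone : pcarrier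
}.

Arguments pzero {p}.
Arguments pone {p}.

(** [pea_assoc] says at once that the two sides exist simultaneously and that
    their values then agree. *)
Record is_pseudo_effect_algebra (E : partial_algebra) : Prop := {
  pea_assoc : forall a b c s : E,
    (exists2 d, padd a b = Some d & padd d c = Some s) <->
    (exists2 d, padd b c = Some d & padd a d = Some s);
  pea_compl : forall a : E,
    (exists! d, padd a d = Some pone) /\ (exists! e, padd e a = Some pone);
  pea_conj : forall a b s : E, padd a b = Some s ->
    exists d e, padd d a = Some s /\ padd b e = Some s;
  pea_top : forall a : E,
    (exists s, padd pone a = Some s) \/ (exists s, padd a pone = Some s) ->
    a = pzero
}.

Definition pea_hom (E F : partial_algebra) (h : E -> F) : Prop :=
  h pone = pone /\
  forall a b c : E, padd a b = Some c -> padd (h a) (h b) = Some (h c).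

Definition pea_isomorphic (E F : partial_algebra) : Prop :=
  exists (h : E -> F) (g : F -> E),
    [/\ cancel h g, cancel g h, pea_hom h & pea_hom g].

(** * Po-groups *)

(** No compatibility axiom here: this is only the join that HB requires for
    po-groups and po-loops to coexist. *)
HB.structure Definition POrderUMagma (d : Order.disp_t) :=
  {M of UMagma M & Order.POrder d M}.

HB.mixin Record isPOGroup (d : Order.disp_t) G
    of Group G & Order.POrder d G := {
  le_mulg : forall a b x y : G, a <= b -> x * a * y <= x * b * y
}.

#[short(type="poGroupType")]
HB.structure Definition POGroup (d : Order.disp_t) :=
  {G of Group G & Order.POrder d G & isPOGroup d G}.

(** * Po-loops *)

HB.mixin Record isPOLoop (d : Order.disp_t) H
    of UMagma H & Order.POrder d H := {
  loop_ldiv : forall a b : H, exists! x, a * x = b;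
  loop_rdiv : forall a b : H, exists! y, y * a = b;
  le_loop_mull : forall c a b : H, a <= b -> c * a <= c * b;
  le_loop_mulr : forall c a b : H, a <= b -> a * c <= b * c
}.

#[short(type="poLoopType")]
HB.structure Definition POLoop (d : Order.disp_t) :=
  {H of UMagma H & Order.POrder d H & isPOLoop d H}.

(** Without associativity the bracketing matters: a^(n+1) = a^n a, whereas
    [a ^+ n.+1] is a * a ^+ n. *)
Fixpoint loop_exp d (H : poLoopType d) (a : H) (n : nat) : H :=
  if n is m.+1 then loop_exp a m * a else 1%g.

Definition strong_unit d (H : poLoopType d) (u : H) : Prop :=
  1%g <= u /\ forall g : H, exists n : nat, g <= loop_exp u n.

Section Gamma.
Context (d : Order.disp_t) (H : poLoopType d) (u : H) (u_ge1 : 1%g <= u).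

Definition gamma_carrier : Type := {h : H | 1%g <= h <= u}.

Lemma gamma_add_subproof (a b : gamma_carrier) :
  val a * val b <= u -> 1%g <= val a * val b <= u.
Proof.
case: a b => [a /= /andP[a1 _]] [b /= /andP[b1 _]] abu.
by rewrite abu andbT (le_trans a1)// -{1}[a]mulg1 le_loop_mull.
Qed.

Definition gamma_add (a b : gamma_carrier) : option gamma_carrier :=
  match pselect (val a * val b <= u) with
  | left abu => Some (exist _ (val a * val b) (gamma_add_subproof abu))
  | right _ => None
  end.

Lemma gamma_zero_subproof : 1%g <= (1%g : H) <= u.
Proof. by rewrite lexx. Qed.

Lemma gamma_one_subproof : 1%g <= u <= u.
Proof. by rewrite u_ge1 lexx. Qed.

Definition Gamma : partial_algebra :=
  PartialAlgebra gamma_add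
    (exist _ 1%g gamma_zero_subproof) (exist _ u gamma_one_subproof).

End Gamma.

(** * Kites *)

Lemma bijective_inverse (I J : Type) (f : I -> J) :
  bijective f -> exists g : J -> I, cancel f g /\ cancel g f.
Proof. by case=> g fK gK; exists g. Qed.

Definition bij_inv (I J : Type) (f : I -> J) (fbij : bijective f) : J -> I :=
  projT1 (cid (bijective_inverse fbij)).

Lemma bij_invK (I J : Type) (f : I -> J) (fbij : bijective f) :
  cancel f (bij_inv fbij).
Proof. by rewrite /bij_inv; case: cid => g []. Qed.

Lemma bij_invKV (I J : Type) (f : I -> J) (fbij : bijective f) :
  cancel (bij_inv fbij) f.
Proof. by rewrite /bij_inv; case: cid => g []. Qed.

Section Kite.
Context (d : Order.disp_t) (G : poGroupType d) (I : Type).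
Context (lam rho : I -> I) (lam_bij : bijective lam) (rho_bij : bijective rho).

Definition pos_seq : Type := {f : I -> G | forall j, 1%g <= f j}.
Definition neg_seq : Type := {x : I -> G | forall i, x i <= 1%g}.

(** The sequence written <a_i^{-1}> with a_i in G^+ is the element
    [x : neg_seq] with x_i = a_i^{-1}, that is a_i = x_i^{-1}. *)
Definition kite_carrier : Type := (pos_seq + neg_seq)%type.

Let lamV := bij_inv lam_bij.
Let rhoV := bij_inv rho_bij.

Lemma kite_addNP_subproof (x : neg_seq) (f : pos_seq) :
  (forall i, sval f (rhoV i) <= (sval x i)^-1) ->
  forall i, sval x i * sval f (rhoV i) <= 1%g.
Proof.
move=> fx i; have := @le_mulg _ _ _ _ (sval x i) 1%g (fx i).
by rewrite !mulg1 mulgV.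
Qed.

Lemma kite_addPN_subproof (f : pos_seq) (x : neg_seq) :
  (forall i, sval f (lamV i) <= (sval x i)^-1) ->
  forall i, sval f (lamV i) * sval x i <= 1%g.
Proof.
move=> fx i; have := @le_mulg _ _ _ _ 1%g (sval x i) (fx i).
by rewrite !mul1g mulVg.
Qed.

Lemma kite_addPP_subproof (f g : pos_seq) :
  forall j, 1%g <= sval f j * sval g j.
Proof.
move=> j; have := @le_mulg _ _ _ _ (sval f j) 1%g (svalP g j).
by rewrite !mulg1; apply: le_trans; exact: svalP f j.
Qed.

Definition kite_add (x y : kite_carrier) : option kite_carrier :=
  match x, y with
  | inr _, inr _ => None
  | inr a, inl f =>
    match pselect (forall i, sval f (rhoV i) <= (sval a i)^-1) with
    | left fa => Some (inr (exist _ (fun i => sval a i * sval f (rhoV i))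
                                    (kite_addNP_subproof fa)))
    | right _ => None
    end
  | inl f, inr a =>
    match pselect (forall i, sval f (lamV i) <= (sval a i)^-1) with
    | left fa => Some (inr (exist _ (fun i => sval f (lamV i) * sval a i)
                                    (kite_addPN_subproof fa)))
    | right _ => None
    end
  | inl f, inl g =>
    Some (inl (exist _ (fun j => sval f j * sval g j)
                       (kite_addPP_subproof f g)))
  end.

Lemma kite_zero_subproof (j : I) : 1%g <= (1%g : G).
Proof. exact: lexx. Qed.

Lemma kite_one_subproof (i : I) : (1%g : G)^-1 <= 1%g.
Proof. by rewrite invg1. Qed.

Definition kite : partial_algebra :=
  PartialAlgebra kite_add
    (inl (exist _ (fun=> 1%g) kite_zero_subproof))
    (inr (exist _ (fun=> 1%g^-1) kite_one_subproof)).

End Kite.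

Arguments kite {d} G {I lam rho} lam_bij rho_bij.

(* Main.v *)
From HB Require Import structures.
Require Import Defs.
From mathcomp Require Import all_boot all_order.
From mathcomp Require Import ssralg ssrnum ssrint.
From mathcomp Require Import boolp.

(** The kite is the unit interval of a lexicographic construction. Take pairs
    (n, x) of an integer n and a sequence x in G^I, with

      (m, x) * (n, y) = (m + n, <x_{lam^{-n}(i)} y_{rho^{-m}(i)} : i in I>),

    ordered first by the integer, then coordinatewise. Multiplication by a
    fixed element is a translation of the level composed with a reindexing of
    the coordinates and a translation in G^I; reindexings by powers of
    bijections are invertible, so this is a loop, and all these maps preserve
    the lexicographic order. In a triple product (m, x), (n, y), (k, z) the two
    bracketings reindex y by rho^{-m} lam^{-k} and by lam^{-k} rho^{-m}; for
    nontrivial G, associativity thus amounts to lam and rho commuting, and in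
    general H is only a loop. The element u = (1, e) is a strong unit because
    u^n = (n, e) lies above every element of level less than n.

    The interval [(0, e), (1, e)] contains exactly the (0, f) with f >= e and
    the (1, x) with x <= e, that is, the two parts of the kite. Within it the
    product only involves the powers lam^0, lam^{-1}, rho^0, rho^{-1} and gives
    back the four rules of the kite addition; two elements of level 1 have a
    product of level 2, which exceeds u, so their sum is undefined
    ([kite_embed_add]). That Gamma(H, u) is a pseudo effect algebra is then
    checked on the kite ([kite_pea]) and carried along the isomorphism
    ([pea_isomorphic_pea]). *)

Set Implicit Arguments.
Unset Strict Implicit.
Unset Printing Implicit Defensive.

Import Order.TTheory.
Local Open Scope group_scope.
Local Open Scope order_scope.

(** * Isomorphisms of partial algebras *)

(** Every axiom speaks only of the graph of the partial addition and of the two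
    constants. *)
Lemma pea_isomorphic_pea (E F : partial_algebra) (h : E -> F) :
  bijective h -> h pzero = pzero -> h pone = pone ->
  (forall a b c, padd (h a) (h b) = Some (h c) <-> padd a b = Some c) ->
  is_pseudo_effect_algebra E -> is_pseudo_effect_algebra F.
Proof.
move=> [g hK gK] h0 h1 hD [Ea Ec Ej Et].
have gD a b c : padd a b = Some c <-> padd (g a) (g b) = Some (g c).
  by rewrite -{1}[a]gK -{1}[b]gK -{1}[c]gK hD.
have g1 : g pone = pone by rewrite -h1 hK.
split.
- move=> a b c s; split=> -[d /gD abd /gD dcs].
    have [|e bce aes] := (Ea (g a) (g b) (g c) (g s)).1; first by exists (g d).
    by exists (h e); apply/gD; rewrite hK.
  have [|e abe ecs] := (Ea (g a) (g b) (g c) (g s)).2; first by exists (g d).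
  by exists (h e); apply/gD; rewrite hK.
- move=> a; have [[d [ad dU]] [e [ea eU]]] := Ec (g a).
  split; [exists (h d)|exists (h e)]; split; rewrite ?gD ?hK ?g1//.
    by move=> x /gD; rewrite g1 => /dU ->; rewrite gK.
  by move=> x /gD; rewrite g1 => /eU ->; rewrite gK.
- move=> a b s /gD /Ej [d [e [da be]]].
  by exists (h d), (h e); rewrite !gD !hK.
- move=> a aP; rewrite -[a]gK -h0; congr h; apply: Et.
  by case: aP => -[s /gD]; rewrite g1 => sP; [left|right]; exists (g s).
Qed.

Lemma bij_pea_isomorphic (E F : partial_algebra) (h : E -> F) :
  bijective h -> h pone = pone ->
  (forall a b c, padd (h a) (h b) = Some (h c) <-> padd a b = Some c) ->
  pea_isomorphic E F.
Proof.
move=> [g hK gK] h1 hD; exists h, g; split=> //; split=> //.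
- by move=> a b c /hD.
- by rewrite -h1 hK.
- by move=> a b c; rewrite -{1}[a]gK -{1}[b]gK -{1}[c]gK hD.
Qed.

(** * Inequalities in po-groups *)

Section POGroupTheory.
Context (d : Order.disp_t) (G : poGroupType d).
Implicit Types x y z : G.

Lemma le_mul2l x y z : x <= y -> z * x <= z * y.
Proof. by move=> /(@le_mulg _ _ _ _ z 1%g); rewrite !mulg1. Qed.

Lemma le_mul2r x y z : x <= y -> x * z <= y * z.
Proof. by move=> /(@le_mulg _ _ _ _ 1%g z); rewrite !mul1g. Qed.

Lemma le_mul_ge1r x y : 1%g <= y -> x <= x * y.
Proof. by move=> /(le_mul2l x); rewrite mulg1. Qed.

Lemma le_mul_ge1l x y : 1%g <= y -> x <= y * x.
Proof. by move=> /(le_mul2r x); rewrite mul1g. Qed.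

Lemma mulg_le1r x y : (x * y <= 1%g) = (y <= x^-1).
Proof.
apply/idP/idP => [/(le_mul2l x^-1)|/(le_mul2l x)].
  by rewrite mulKg mulg1.
by rewrite mulgV.
Qed.

Lemma mulg_le1l x y : (x * y <= 1%g) = (x <= y^-1).
Proof.
apply/idP/idP => [/(le_mul2r y^-1)|/(le_mul2r y)].
  by rewrite mulgK mul1g.
by rewrite mulVg.
Qed.

Lemma invg_le1 x : (x^-1 <= 1%g) = (1%g <= x).
Proof. by rewrite -[x^-1]mulg1 mulg_le1r invgK. Qed.

Lemma invg_ge1 x : (1%g <= x^-1) = (x <= 1%g).
Proof. by rewrite -mulg_le1r mulg1. Qed.

Lemma conjg_ge1 x y : 1%g <= y -> 1%g <= x * y * x^-1.
Proof. by move=> /(@le_mulg _ _ _ _ x x^-1); rewrite mulg1 mulgV. Qed.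

End POGroupTheory.

(** * The kite is a pseudo effect algebra *)

Section KitePea.
Context (d : Order.disp_t) (G : poGroupType d) (I : Type).
Context (lam rho : I -> I) (lam_bij : bijective lam) (rho_bij : bijective rho).

Local Notation K := (kite G lam_bij rho_bij).
Local Notation lamV := (bij_inv lam_bij).
Local Notation rhoV := (bij_inv rho_bij).

Lemma sub_seq_ext (P : (I -> G) -> Prop) (x y : {z : I -> G | P z}) :
  (forall i, sval x i = sval y i) -> x = y.
Proof.
by case: x y => [x Px] [y Py] /= xy; apply: eq_exist; apply/funext.
Qed.

(** The graph of the addition with no explicit domain conditions: those amount
    to saying that the result belongs to the negative part, which the type of
    [z] records. *)
Definition kite_sum (x y z : K) : Prop :=
  match x, y, z with
  | inl f, inl g, inl s => forall j, sval s j = sval f j * sval g j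
  | inr a, inl f, inr s => forall i, sval s i = sval a i * sval f (rhoV i)
  | inl f, inr a, inr s => forall i, sval s i = sval f (lamV i) * sval a i
  | _, _, _ => False
  end.

Lemma kite_addP (x y z : K) : padd x y = Some z <-> kite_sum x y z.
Proof.
case: x y z => [f|a] [g|b] [s|s] //=.
- split=> [[<-] //|sE]; congr (Some (inl _)).
  by apply: sub_seq_ext => j /=; rewrite sE.
- by case: pselect.
- case: pselect => /= fb; split.
  + by case=> <-.
  + move=> sE; congr (Some (inr _)).
    by apply: sub_seq_ext => j /=; rewrite sE.
  + by [].
  + move=> sE; case: fb => i; rewrite -mulg_le1l -sE; exact: (svalP s).
- by case: pselect.
- case: pselect => /= fb; split.
  + by case=> <-.
  + move=> sE; congr (Some (inr _)).
    by apply: sub_seq_ext => j /=; rewrite sE.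
  + by [].
  + move=> sE; case: fb => i; rewrite -mulg_le1r -sE; exact: (svalP s).
Qed.

(** The two iterated sums have the same value by associativity in [G]. The
    inner sum of one bracketing exists as soon as the other bracketing does:
    erasing a positive factor
    from a product below [e] keeps it below [e]. *)
Lemma kite_assoc (a b c s : K) :
  (exists2 t, padd a b = Some t & padd t c = Some s) <->
  (exists2 t, padd b c = Some t & padd a t = Some s).
Proof.
split=> -[t /kite_addP abt /kite_addP tcs].
- suff [z bcz azs] : exists2 z, kite_sum b c z & kite_sum a z s.
    by exists z; apply/kite_addP.
  case: a b c s t abt tcs => [f|a] [g|b] [h|c] [s|s] [t|t] //= abt tcs.
  + exists (inl (exist _ (fun j => sval g j * sval h j)
                         (kite_addPP_subproof g h))) => //= j.
    by rewrite tcs abt mulgA.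
  + have gcP i : sval g (lamV i) * sval c i <= 1%g.
      apply: le_trans (svalP s i); rewrite tcs abt -mulgA.
      by apply: le_mul_ge1l; exact: (svalP f).
    exists (inr (exist _ (fun i => sval g (lamV i) * sval c i) gcP)) => //= i.
    by rewrite tcs abt mulgA.
  + have bhP i : sval b i * sval h (rhoV i) <= 1%g.
      apply: le_trans (svalP s i); rewrite tcs abt -mulgA.
      by apply: le_mul_ge1l; exact: (svalP f).
    exists (inr (exist _ (fun i => sval b i * sval h (rhoV i)) bhP)) => //= i.
    by rewrite tcs abt mulgA.
  + exists (inl (exist _ (fun j => sval g j * sval h j)
                         (kite_addPP_subproof g h))) => //= i.
    by rewrite tcs abt mulgA.
- suff [z abz zcs] : exists2 z, kite_sum a b z & kite_sum z c s.
    by exists z; apply/kite_addP.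
  case: a b c s t abt tcs => [f|a] [g|b] [h|c] [s|s] [t|t] //= bct ats.
  + exists (inl (exist _ (fun j => sval f j * sval g j)
                         (kite_addPP_subproof f g))) => //= j.
    by rewrite ats bct mulgA.
  + exists (inl (exist _ (fun j => sval f j * sval g j)
                         (kite_addPP_subproof f g))) => //= i.
    by rewrite ats bct mulgA.
  + have fbP i : sval f (lamV i) * sval b i <= 1%g.
      apply: le_trans (svalP s i); rewrite ats bct mulgA.
      by apply: le_mul_ge1r; exact: (svalP h).
    exists (inr (exist _ (fun i => sval f (lamV i) * sval b i) fbP)) => //= i.
    by rewrite ats bct mulgA.
  + have agP i : sval a i * sval g (rhoV i) <= 1%g.
      apply: le_trans (svalP s i); rewrite ats bct mulgA.
      by apply: le_mul_ge1r; exact: (svalP h).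
    exists (inr (exist _ (fun i => sval a i * sval g (rhoV i)) agP)) => //= i.
    by rewrite ats bct mulgA.
Qed.

(** A sum equal to the top has one summand from each part, and reading the
    equation in [G] determines either summand as a reindexed inverse of the
    other. *)
Lemma kite_compl (a : K) :
  (exists! x, padd a x = Some pone) /\ (exists! y, padd y a = Some pone).
Proof.
case: a => [f|a].
- have fP (s : I -> I) i : (sval f (s i))^-1 <= 1%g.
    by rewrite invg_le1; exact: (svalP f).
  split.
    exists (inr (exist _ (fun i => (sval f (lamV i))^-1) (fP lamV))); split.
      by apply/kite_addP => /= i; rewrite mulgV invg1.
    move=> [x|x] /kite_addP //= xE; congr inr; apply: sub_seq_ext => i /=.
    by apply: (mulgI (sval f (lamV i))); rewrite -xE mulgV invg1.
  exists (inr (exist _ (fun i => (sval f (rhoV i))^-1) (fP rhoV))); split.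
    by apply/kite_addP => /= i; rewrite mulVg invg1.
  move=> [x|x] /kite_addP //= xE; congr inr; apply: sub_seq_ext => i /=.
  by apply: (mulIg (sval f (rhoV i))); rewrite -xE mulVg invg1.
- have aP (s : I -> I) j : 1%g <= (sval a (s j))^-1.
    by rewrite invg_ge1; exact: (svalP a).
  split.
    (* The sum [a + x] pairs the coordinate [i] of [a] with the coordinate
       rho^{-1}(i) of the summand sought, so its coordinate [j] meets
       [a (rho j)]; the other order gives [lam] instead. *)
    exists (inl (exist _ (fun j => (sval a (rho j))^-1) (aP rho))); split.
      by apply/kite_addP => /= i; rewrite bij_invKV mulgV invg1.
    move=> [x|x] /kite_addP //= xE; congr inl; apply: sub_seq_ext => j /=.
    apply: (mulgI (sval a (rho j))).
    by rewrite -[X in sval x X](bij_invK rho_bij) -xE mulgV invg1.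
  exists (inl (exist _ (fun j => (sval a (lam j))^-1) (aP lam))); split.
    by apply/kite_addP => /= i; rewrite bij_invKV mulVg invg1.
  move=> [x|x] /kite_addP //= xE; congr inl; apply: sub_seq_ext => j /=.
  apply: (mulIg (sval a (lam j))).
  by rewrite -[X in sval x X](bij_invK lam_bij) -xE mulVg invg1.
Qed.

(** The equations are solved coordinatewise in [G]. A summand needed in the
    positive part is a conjugate of a positive element, hence positive; one
    needed in the negative part is the sum [s], which lies below [e], multiplied
    by the inverse of a positive element. *)
Lemma kite_conj (a b s : K) : padd a b = Some s ->
  exists x y, padd x a = Some s /\ padd b y = Some s.
Proof.
move=> /kite_addP abs.
suff [x [y [xa yb]]] : exists x y, kite_sum x a s /\ kite_sum b y s.
  by exists x, y; split; apply/kite_addP.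
case: a b s abs => [f|a] [g|b] [s|s] //= sE.
- have xP j : 1%g <= sval f j * sval g j * (sval f j)^-1.
    by apply: conjg_ge1; exact: (svalP g).
  have yP j : 1%g <= (sval g j)^-1 * sval f j * sval g j.
    by rewrite -{2}[sval g j]invgK; apply: conjg_ge1; exact: (svalP f).
  exists (inl (exist _ _ xP)), (inl (exist _ _ yP)).
  by split=> j /=; rewrite sE ?mulgVK// -mulgA mulVKg.
- have xP i : sval s i * (sval f (rhoV i))^-1 <= 1%g.
    by rewrite mulg_le1l invgK (le_trans (svalP s i)) ?(svalP f).
  have yP j :
      1%g <= (sval b (rho j))^-1 * sval f (lamV (rho j)) * sval b (rho j).
    by rewrite -{2}[sval b (rho j)]invgK; apply: conjg_ge1; exact: (svalP f).
  exists (inr (exist _ _ xP)), (inl (exist _ _ yP)); split=> i /=.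
    by rewrite mulgVK.
  by rewrite bij_invKV sE -mulgA mulVKg.
- have xP j :
      1%g <= sval a (lam j) * sval g (rhoV (lam j)) * (sval a (lam j))^-1.
    by apply: conjg_ge1; exact: (svalP g).
  have yP i : (sval g (lamV i))^-1 * sval s i <= 1%g.
    by rewrite mulg_le1r invgK (le_trans (svalP s i)) ?(svalP g).
  exists (inl (exist _ _ xP)), (inr (exist _ _ yP)); split=> i /=.
    by rewrite bij_invKV sE mulgVK.
  by rewrite mulVKg.
Qed.

Lemma kite_top (a : K) :
  (exists s, padd pone a = Some s) \/ (exists s, padd a pone = Some s) ->
  a = pzero.
Proof.
case: a => [f|a]; last by case=> -[s /kite_addP].
case=> -[[s|s] /kite_addP //= sE]; congr inl; apply: sub_seq_ext => j /=;
    apply: le_anti; rewrite (svalP f) andbT.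
  by have := svalP s (rho j); rewrite sE bij_invK invg1 mul1g.
by have := svalP s (lam j); rewrite sE bij_invK invg1 mulg1.
Qed.

Lemma kite_pea : is_pseudo_effect_algebra K.
Proof.
split; [exact: kite_assoc|exact: kite_compl|exact: kite_conj|exact: kite_top].
Qed.

End KitePea.

(** * The lexicographic po-loop *)

Section KiteLoop.
Context (d : Order.disp_t) (G : poGroupType d) (I : Type).
Context (lam rho : I -> I).

(** [shift f_bij n] is the power f^{-n}. *)
Definition shift (f : I -> I) (f_bij : bijective f) (n : int) : I -> I :=
  match n with
  | Posz k => iter k (bij_inv f_bij)
  | Negz k => iter k.+1 f
  end.

Lemma iter_bij (f : I -> I) k : bijective f -> bijective (iter k f).
Proof.
move=> f_bij; elim: k => [|k IHk]; first by exists id.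
exact: (bij_comp f_bij IHk).
Qed.

Lemma shift_bij (f : I -> I) (f_bij : bijective f) n :
  bijective (shift f_bij n).
Proof.
case: n => k; apply: iter_bij => //.
exact: Bijective (bij_invKV f_bij) (bij_invK f_bij).
Qed.

(** The bijectivity proofs are parameters of the type so that its operations
    are determined by it. *)
Definition kite_loop (lam_bij : bijective lam) (rho_bij : bijective rho) :=
  (int * (I -> G))%type.

Context (lam_bij : bijective lam) (rho_bij : bijective rho).
Local Notation H := (kite_loop lam_bij rho_bij).
Implicit Types p q r : H.

Definition kite_loop_mul p q : H :=
  ((p.1 + q.1)%R,
   fun i => p.2 (shift lam_bij q.1 i) * q.2 (shift rho_bij p.1 i)).

Definition kite_loop_one : H := (0%R, fun=> 1%g).

Definition kite_loop_le p q : bool :=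
  `[< (p.1 < q.1)%R \/ p.1 = q.1 /\ forall i, p.2 i <= q.2 i >].

Lemma kite_loop_le_refl : reflexive kite_loop_le.
Proof. by move=> p; apply/asboolP; right. Qed.

Lemma kite_loop_le_anti : antisymmetric kite_loop_le.
Proof.
move=> [m x] [n y] /andP[/asboolP /= pq /asboolP /= qp].
case: pq qp => [mn|[-> xy]] [|[]].
- by move/(lt_trans mn); rewrite ltxx.
- by move=> nm; move: mn; rewrite nm ltxx.
- by rewrite ltxx.
- move=> _ yx; congr pair; apply/funext => i.
  by apply: le_anti; rewrite xy yx.
Qed.

Lemma kite_loop_le_trans : transitive kite_loop_le.
Proof.
move=> [n y] [m x] [k z] /asboolP /= pq /asboolP /= qr; apply/asboolP => /=.
case: pq qr => [mn|[-> xy]] [nk|[<- yz]].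
- by left; apply: lt_trans nk.
- by left.
- by left.
- by right; split=> // i; apply: le_trans (yz i).
Qed.

Lemma kite_loop_mul1p : left_id kite_loop_one kite_loop_mul.
Proof.
move=> [n x]; congr pair => /=; first by rewrite GRing.add0r.
by apply/funext => i; rewrite mul1g.
Qed.

Lemma kite_loop_mulp1 : right_id kite_loop_one kite_loop_mul.
Proof.
move=> [n x]; congr pair => /=; first by rewrite GRing.addr0.
by apply/funext => i; rewrite mulg1.
Qed.

(** Solving for [x] in [p * x = q] fixes its level, hence the reindexing of the
    coordinates of [p]; the coordinates of [x] are then read off after undoing
    their own reindexing. *)
Lemma kite_loop_ldiv p q : exists! x, kite_loop_mul p x = q.
Proof.
case: p q => [m x] [n y]; have [s sK Ks] := shift_bij rho_bij m.
exists ((n - m)%R,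
  fun j => (x (shift lam_bij (n - m)%R (s j)))^-1 * y (s j)).
split=> [|[k z] [/= <- <-]].
  congr pair; first by rewrite /= GRing.addrC GRing.subrK.
  by apply/funext => i /=; rewrite sK mulVKg.
rewrite [(m + k)%R]GRing.addrC GRing.addrK; congr pair.
by apply/funext => j; rewrite Ks mulKg.
Qed.

Lemma kite_loop_rdiv p q : exists! x, kite_loop_mul x p = q.
Proof.
case: p q => [m x] [n y]; have [s sK Ks] := shift_bij lam_bij m.
exists ((n - m)%R,
  fun j => y (s j) * (x (shift rho_bij (n - m)%R (s j)))^-1).
split=> [|[k z] [/= <- <-]].
  congr pair; first by rewrite /= GRing.subrK.
  by apply/funext => i /=; rewrite sK mulgVK.
rewrite GRing.addrK; congr pair.
by apply/funext => j; rewrite Ks mulgK.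
Qed.

Lemma kite_loop_le_mull r p q :
  kite_loop_le p q -> kite_loop_le (kite_loop_mul r p) (kite_loop_mul r q).
Proof.
move=> /asboolP pq; apply/asboolP => /=; rewrite Num.Theory.ltrD2l.
case: pq => [|[-> pq]]; [by left|right; split=> // i].
exact: le_mul2l.
Qed.

Lemma kite_loop_le_mulr r p q :
  kite_loop_le p q -> kite_loop_le (kite_loop_mul p r) (kite_loop_mul q r).
Proof.
move=> /asboolP pq; apply/asboolP => /=; rewrite Num.Theory.ltrD2r.
case: pq => [|[-> pq]]; [by left|right; split=> // i].
exact: le_mul2r.
Qed.

HB.instance Definition _ := gen_eqMixin H.
HB.instance Definition _ := gen_choiceMixin H.
HB.instance Definition _ := hasMul.Build H kite_loop_mul.
HB.instance Definition _ :=
  Magma_isUMagma.Build H kite_loop_mul1p kite_loop_mulp1.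
HB.instance Definition _ := Order.Le_isPOrder.Build d H
  kite_loop_le_refl kite_loop_le_anti kite_loop_le_trans.
HB.instance Definition _ := isPOLoop.Build d H
  kite_loop_ldiv kite_loop_rdiv kite_loop_le_mull kite_loop_le_mulr.

Definition kite_unit : H := (1%R, fun=> 1%g).

Lemma kite_loop_leP p q :
  reflect ((p.1 < q.1)%R \/ p.1 = q.1 /\ forall i, p.2 i <= q.2 i) (p <= q).
Proof. exact: asboolP. Qed.

Lemma kite_unit_exp n : loop_exp kite_unit n = (Posz n, fun=> 1%g) :> H.
Proof.
elim: n => [//|n IHn] /=; rewrite IHn; congr pair => /=.
  by rewrite -PoszD addn1.
by apply/funext => i; rewrite mulg1.
Qed.

Lemma kite_unit_strong : strong_unit kite_unit.
Proof.
split=> [|[m x]]; first by apply/kite_loop_leP; left.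
exists (absz m).+1; apply/kite_loop_leP; left; rewrite kite_unit_exp /=.
by rewrite (le_lt_trans (Num.Theory.ler_norm m))// -abszE ltz_nat.
Qed.

End KiteLoop.

(** * The kite as an interval of the loop *)

Lemma Gamma_ext d (H : poLoopType d) (u : H) (u_ge1 : 1%g <= u)
    (a b : Gamma u_ge1) : sval a = sval b -> a = b.
Proof. by case: a b => [a aP] [b bP] /= ab; apply: eq_exist. Qed.

(** The sum is defined exactly when the product stays in the interval, so the
    partial addition is the graph of the product restricted to the interval. *)
Lemma Gamma_addP d (H : poLoopType d) (u : H) (u_ge1 : 1%g <= u)
    (a b c : Gamma u_ge1) :
  padd a b = Some c <-> sval a * sval b = sval c.
Proof.
rewrite /= /gamma_add; case: pselect => /= [abu|nabu]; split=> //.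
- by case=> <-.
- by move=> abc; congr Some; apply: Gamma_ext.
- by move=> abc; case: nabu; rewrite abc; case/andP: (svalP c).
Qed.

Section KiteEmbedding.
Context (d : Order.disp_t) (G : poGroupType d) (I : Type).
Context (lam rho : I -> I) (lam_bij : bijective lam) (rho_bij : bijective rho).

Local Notation K := (kite G lam_bij rho_bij).
Local Notation H := (kite_loop G lam_bij rho_bij).
Local Notation u := (kite_unit G lam_bij rho_bij).
Local Notation GammaH := (Gamma (proj1 (kite_unit_strong G lam_bij rho_bij))).

Definition kite_point (x : K) : H :=
  match x with
  | inl f => (0%R, sval f)
  | inr a => (1%R, sval a)
  end.

Lemma kite_point_itv (x : K) : 1%g <= kite_point x <= u.
Proof.
case: x => [f|a]; apply/andP; split; apply/kite_loop_leP; try by left.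
  by right; split=> //; exact: (svalP f).
by right; split=> //; exact: (svalP a).
Qed.

Definition kite_embed (x : K) : GammaH :=
  exist (fun p : H => 1%g <= p <= u) (kite_point x) (kite_point_itv x).

Lemma kite_point_inj : injective kite_point.
Proof.
by move=> [f|a] [g|b] //= [fg]; congr (_ _); apply: sub_seq_ext => i;
  rewrite fg.
Qed.

(** The lexicographic order forces the level of an element between [1] and [u]
    to be 0 or 1, and on these two levels the bounds compare coordinates with
    the identity of [G]. *)
Lemma kite_point_surj (p : H) : 1%g <= p <= u -> exists x, kite_point x = p.
Proof.
case: p => [n x] /andP[/kite_loop_leP /= p1 /kite_loop_leP /= pu].
case: p1 => [n_gt0|[<- x_ge1]]; last by exists (inl (exist _ x x_ge1)).
case: pu => [n_lt1|[-> x_le1]]; last by exists (inr (exist _ x x_le1)).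
by case: n n_gt0 n_lt1 => [[|k]|k].
Qed.

Lemma kite_embed_bij : bijective kite_embed.
Proof.
have surj (p : GammaH) : exists x, kite_embed x = p.
  have [x xp] := kite_point_surj (svalP p).
  by exists x; apply: Gamma_ext.
exists (fun p => projT1 (cid (surj p))) => [x|p]; last by case: cid.
by case: cid => /= y /(congr1 sval) /= /kite_point_inj.
Qed.

Lemma kite_embed0 : kite_embed pzero = pzero.
Proof. by apply: (Gamma_ext (a := kite_embed pzero)). Qed.

Lemma kite_embed1 : kite_embed pone = pone.
Proof.
apply: (Gamma_ext (a := kite_embed pone)); congr pair.
by apply/funext => i; exact: invg1.
Qed.

(** The shifts at levels 0 and 1 are the identity and the inverse of the
    bijection, so equality of second coordinates is the defining equation of
    the kite sum; the equation between levels excludes the sign patterns for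
    which no sum exists. *)
Lemma kite_embed_add (a b c : K) :
  padd (kite_embed a) (kite_embed b) = Some (kite_embed c) <->
  padd a b = Some c.
Proof.
rewrite Gamma_addP kite_addP /=.
case: a b c => [f|a] [g|b] [s|s] //=; split=> //.
all: try by case=> sE i; rewrite -sE.
all: by move=> sE; congr pair; apply/funext => i; rewrite sE.
Qed.

End KiteEmbedding.

Theorem theorem4p1 (d : Order.disp_t) (G : poGroupType d) (I : Type)
    (lam rho : I -> I) (lam_bij : bijective lam) (rho_bij : bijective rho) :
  exists (d' : Order.disp_t) (H : poLoopType d') (u : H)
         (u_strong : strong_unit u),
    is_pseudo_effect_algebra (Gamma (proj1 u_strong)) /\
    pea_isomorphic (kite G lam_bij rho_bij) (Gamma (proj1 u_strong)).
Proof.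
exists d, (kite_loop G lam_bij rho_bij : poLoopType d),
  (kite_unit G lam_bij rho_bij), (kite_unit_strong G lam_bij rho_bij).
have h_bij := kite_embed_bij G lam_bij rho_bij.
have hD := @kite_embed_add _ G I _ _ lam_bij rho_bij.
have h0 := kite_embed0 G lam_bij rho_bij.
have h1 := kite_embed1 G lam_bij rho_bij.
split; last exact: (bij_pea_isomorphic h_bij).
exact: (pea_isomorphic_pea h_bij _ _ hD (kite_pea _ _ _)).
Qed.
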